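(* Let $q$ be a non-zero complex number such that $q^{6k}\neq 1$ for all non-zero integers $k$, $q\notin P_m\cup R_m$ for every non-zero even integer $m$, and $q\notin S_n$ for every non-zero integer $n$. Let $r\geq 1$ be an integer and let $A_1,\dots,A_r\in\{\alpha_1,\alpha_2,\alpha_1\alpha_2,\alpha_2\alpha_1,\alpha_1\alpha_2\alpha_1\}$ be such that $\sum_{i=1}^r\mathrm{length}(A_i)$ is even. Let $x\in C_3$ be $$x=A_1TA_2T\cdots A_{r-1}TA_rT^{1-r}\quad\text{or}\quad x=T^{1-r}A_1TA_2T\cdots A_{r-1}TA_r.$$ If $A_i=A_j$ for all $1\le i,j\le r$, then $x\notin\ker\rho$.
   Context: $C_3$ is the group of conjugating automorphisms of the free group $\mathbb{F}_3=\langle x_1,x_2,x_3\rangle$, i.e. the subgroup of $\mathrm{Aut}(\mathbb{F}_3)$ of those $\phi$ with $\phi(x_i)=f_i^{-1}x_{\Pi(i)}f_i$ for a permutation $\Pi$ of $\{1,2,3\}$ and some $f_i\in\mathbb{F}_3$. It is presented by generators $\sigma_1,\sigma_2,\alpha_1,\alpha_2$ and relations $\sigma_1\sigma_2\sigma_1=\sigma_2\sigma_1\sigma_2$, $\alpha_1^2=\alpha_2^2=1$, $\alpha_1\alpha_2\alpha_1=\alpha_2\alpha_1\alpha_2$, $\sigma_1\alpha_2\alpha_1=\alpha_2\alpha_1\sigma_2$, $\sigma_2\sigma_1\alpha_2=\alpha_1\sigma_2\sigma_1$. For a fixed non-zero complex number $q$, the representation $\rho:C_3\to GL_3(\mathbb{C})$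 is the homomorphism given by $$\rho(\sigma_1)=\begin{pmatrix} q^2&0&0\\ q(q-1)&1-q&q\\ 0&1&0\end{pmatrix},\quad \rho(\sigma_2)=\begin{pmatrix}1-q&q&q(q-1)\\1&0&0\\0&0&q^2\end{pmatrix},$$ $$\rho(\alpha_1)=\begin{pmatrix}1&0&0\\0&0&1\\0&1&0\end{pmatrix},\quad \rho(\alpha_2)=\begin{pmatrix}0&1&0\\1&0&0\\0&0&1\end{pmatrix}.$$ $T=\sigma_2\alpha_2\alpha_1\in C_3$. The length of a word is the sum of the absolute values of the exponents of the generators in it; thus $\alpha_1,\alpha_2$ have length $1$, $\alpha_1\alpha_2,\alpha_2\alpha_1$ have length $2$, and $\alpha_1\alpha_2\alpha_1$ has length $3$. For $k\in\mathbb{Z}$, define the following subsets of $\mathbb{C}^*=\mathbb{C}\setminus\{0\}$: $P_k$ is the set of $x\in\mathbb{C}^*\setminus\{4\}$ satisfying both $(2x)^{-2k}(x^2-2x-\sqrt{x-4}\,x^{3/2})^{2k}=1$ and $(2x)^{-2k}(x^2-2x+\sqrt{x-4}\,x^{3/2})^{2k}=1$; $R_k$ is the set of $x\in\mathbb{C}^*\setminus\{1/4\}$ satisfying both $(2x)^{-2k}(1-2x-\sqrt{1-4x})^{2k}=1$ and $(2x)^{-2k}(1-2x+\sqrt{1-4x})^{2k}=1$; $S_k$ is the set of $x\in\mathbb{C}^*$ satisfying $x^{-2k}(1-x)^{2k}=1$. Here $\sqrt{x-4}\,x^{3/2}$ denotes a square root of $(x-4)x^3$ and $\sqrt{1-4x}$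 a square root of $1-4x$; since both signs occur in the conditions, the sets do not depend on the choice. *)

(* Defs.v *)
From HB Require Import structures.
From mathcomp Require Import all_boot all_order all_fingroup all_algebra.
From mathcomp Require Import complex boolp classical_sets reals.
From mathcomp Require Import ring.

Set Implicit Arguments.
Unset Strict Implicit.
Unset Printing Implicit Defensive.

Import GRing.Theory Num.Theory.

Local Open Scope group_scope.

Section FreeGroup.
Variable I : choiceType.

(* (i, false) stands for x_i and (i, true) for its inverse. *)
Definition letter : Type := (I * bool)%type.
Implicit Types (a b : letter) (u v w : seq letter).

Definition linv a : letter := (a.1, ~~ a.2).

Definition reduced w : bool := sorted (fun a b => b != linv a) w.

Definition lcons a w : seq letter :=
  if w is b :: w' then if b == linv a then w' else a :: w else [:: a].

Definition lreduce u v : seq letter := foldr lcons v u.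

Definition winv w : seq letter := rev [seq linv a | a <- w].

Lemma linvK : involutive linv.
Proof. by case=> i b; rewrite /linv /= negbK. Qed.

Lemma lcons_reduced a w : reduced w -> reduced (lcons a w).
Proof.
case: w => //= b w; case: ifPn => [_|ne] /=; last by move=> ->; rewrite ne.
by case: w => //= c w /andP[].
Qed.

Lemma lreduce_reduced u v : reduced v -> reduced (lreduce u v).
Proof. by move=> rv; elim: u => //= a u; apply: lcons_reduced. Qed.

Lemma lconsK a w : reduced w -> lcons (linv a) (lcons a w) = w.
Proof.
case: w => [|b w] /=; first by rewrite linvK eqxx.
case: (altP (b =P linv a)) => [->|_]; last by rewrite /= linvK eqxx.
by case: w => //= c w /andP[/negbTE ->].
Qed.

Lemma lreduce_lcons a u v : reduced u -> reduced v ->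
  lreduce (lcons a u) v = lcons a (lreduce u v).
Proof.
case: u => //= b u _ rv; case: ifPn => // /eqP ->.
by have := lconsK (linv a) (lreduce_reduced u rv); rewrite linvK.
Qed.

Lemma lreduceA u v w : reduced v -> reduced w ->
  lreduce (lreduce u v) w = lreduce u (lreduce v w).
Proof.
move=> rv rw; elim: u => //= a u IHu.
by rewrite lreduce_lcons ?lreduce_reduced // IHu.
Qed.

Lemma lreduce_nil u : reduced u -> lreduce u [::] = u.
Proof.
elim: u => //= a u IHu pu; rewrite IHu; last exact: path_sorted pu.
by case: u pu {IHu} => //= b u /andP[/negbTE ->].
Qed.

Lemma winv_cons a w : winv (a :: w) = rcons (winv w) (linv a).
Proof. by rewrite /winv /= rev_cons. Qed.

Lemma lreduce_winvl w v : reduced v -> lreduce (winv w) (lreduce w v) = v.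
Proof.
elim: w v => //= a w IHw v rv.
by rewrite winv_cons /lreduce foldr_rcons lconsK ?lreduce_reduced //; apply: IHw.
Qed.

Lemma winvK : involutive winv.
Proof.
move=> w; rewrite /winv map_rev revK -map_comp -[RHS]map_id.
by apply: eq_map => a; apply: linvK.
Qed.

Lemma winv_reduced w : reduced w -> reduced (winv w).
Proof.
rewrite /reduced /winv rev_sorted sorted_map; apply: sub_sorted => a b /=.
by rewrite linvK; apply: contra => /eqP ->.
Qed.

Definition freegroup : Type := {w : seq letter | reduced w}.

HB.instance Definition _ := Choice.on freegroup.

Definition fg_one : freegroup := exist _ [::] isT.
Definition fg_mul (u v : freegroup) : freegroup :=
  exist _ (lreduce (val u) (val v)) (lreduce_reduced (val u) (valP v)).
Definition fg_inv (u : freegroup) : freegroup :=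
  exist _ (winv (val u)) (winv_reduced (valP u)).

Fact fg_mulA : associative fg_mul.
Proof.
by move=> u v w; apply: val_inj; rewrite /= lreduceA //; apply: valP.
Qed.
Fact fg_mul1 : left_id fg_one fg_mul.
Proof. by move=> u; apply: val_inj. Qed.
Fact fg_mulr1 : right_id fg_one fg_mul.
Proof. by move=> u; apply: val_inj; rewrite /= lreduce_nil //; apply: valP. Qed.
Fact fg_mulV : left_inverse fg_one fg_inv fg_mul.
Proof.
move=> u; apply: val_inj => /=; rewrite -[X in lreduce _ X]lreduce_nil.
  by rewrite lreduce_winvl.
exact: valP.
Qed.
Fact fg_mulrV : right_inverse fg_one fg_inv fg_mul.
Proof.
move=> u; rewrite -[RHS](fg_mulV (fg_inv u)); congr fg_mul.
by apply: val_inj; rewrite /= winvK.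
Qed.

HB.instance Definition _ := isGroup.Build freegroup
  fg_mulA fg_mul1 fg_mulr1 fg_mulV fg_mulrV.

Definition fgen (i : I) : freegroup := exist _ [:: (i, false)] isT.

Definition fg_letter (a : letter) : freegroup :=
  if a.2 then (fgen a.1)^-1 else fgen a.1.

Lemma fg_ind (P : freegroup -> Prop) :
  P 1 -> (forall a (u : freegroup), P u -> P (fg_letter a * u)) -> forall u : freegroup, P u.
Proof.
move=> P1 PM [w rw]; elim: w rw => [|a w IHw] rw.
  by rewrite (_ : exist _ _ _ = fg_one) //; apply: val_inj.
have rw' : reduced w by exact: path_sorted rw.
have -> : exist _ (a :: w) rw = fg_letter a * (exist _ w rw' : freegroup)
    :> freegroup; last exact: PM.
apply: val_inj; rewrite /= /fg_letter; case: a rw => i b rw.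
have -> : val (if b then (fgen i)^-1 else fgen i) = [:: (i, b)] by case: b rw.
by rewrite /=; case: {IHw} w rw rw' => //= c w /andP[/negbTE ->].
Qed.

Section Lift.
Variables (G : groupType) (f : I -> G).

Definition lift_letter (a : letter) : G := if a.2 then (f a.1)^-1 else f a.1.

Definition fg_lift (u : freegroup) : G :=
  foldr (fun a g => lift_letter a * g) 1 (val u).

Fact fg_liftM : {morph fg_lift : u v / u * v}.
Proof.
move=> [u ru] [v rv]; rewrite /fg_lift /= {ru rv}.
have E a w : foldr (fun a g => lift_letter a * g) 1 (lcons a w)
    = lift_letter a * foldr (fun a g => lift_letter a * g) 1 w.
  case: w => //= b w; case: ifPn => // /eqP ->.
  by rewrite mulgA /lift_letter /=; case: a.2; rewrite ?mulgV ?mulVg mul1g.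
by elim: u => [|a u IHu] /=; rewrite ?mul1g // E IHu mulgA.
Qed.
HB.instance Definition _ := isMultiplicative.Build freegroup G fg_lift fg_liftM.

Lemma fg_lift_gen i : fg_lift (fgen i) = f i.
Proof. by rewrite /fg_lift /= mulg1. Qed.

End Lift.

End FreeGroup.
Arguments fgen {I} i.

Lemma gmorph1 (G H : groupType) (f : G -> H) :
  {morph f : x y / x * y} -> f 1 = 1.
Proof. by move=> fM; apply: (mulgI (f 1)); rewrite -fM !mulg1. Qed.

Lemma gmorphV (G H : groupType) (f : G -> H) :
  {morph f : x y / x * y} -> {morph f : x / x^-1}.
Proof.
by move=> fM x; apply: (mulgI (f x)); rewrite -fM !mulgV (gmorph1 fM).
Qed.

Lemma fg_morph_ext (I : choiceType) (G : groupType) (f g : freegroup I -> G) :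
  {morph f : x y / x * y} -> {morph g : x y / x * y} ->
  (forall i, f (fgen i) = g (fgen i)) -> f =1 g.
Proof.
move=> fM gM fg; apply: fg_ind => [|a u IHu]; first by rewrite !gmorph1.
rewrite fM gM IHu /fg_letter; case: a.2; last by rewrite fg.
by rewrite (gmorphV fM) (gmorphV gM) fg.
Qed.

Section Automorphisms.
Variable G : groupType.

Definition is_aut (f : G -> G) : bool :=
  `[< {morph f : x y / x * y} /\ bijective f >].

Definition aut : Type := {f : G -> G | is_aut f}.
Definition MkAut (f : G -> G) (f_aut : is_aut f) : aut := exist _ f f_aut.

HB.instance Definition _ := Choice.on aut.

Fact is_aut_id : is_aut id.
Proof. by apply/asboolP; split=> //; exists id. Qed.

Fact is_aut_comp f g : is_aut f -> is_aut g -> is_aut (fun x => g (f x)).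
Proof.
move=> /asboolP[fM fb] /asboolP[gM gb]; apply/asboolP.
by split; [move=> x y; rewrite fM gM | exact: bij_comp gb fb].
Qed.

Fact aut_inv_subproof (f : aut) :
  {g : G -> G | is_aut g & cancel (val f) g /\ cancel g (val f)}.
Proof.
have /asboolP[fM fb] := valP f.
have /cid[g [fK gK]] : exists g, cancel (val f) g /\ cancel g (val f).
  by case: fb => g; exists g.
exists g => //; apply/asboolP; split; last by exists (val f).
by move=> x y; apply: (can_inj fK); rewrite fM !gK.
Qed.

Definition aut_one : aut := MkAut is_aut_id.
(* Automorphisms act on the right: the product f * g applies f first. *)
Definition aut_mul (f g : aut) : aut :=
  @MkAut (fun x => val g (val f x)) (is_aut_comp (valP f) (valP g)).
Definition aut_inv (f : aut) : aut :=
  MkAut (s2valP (aut_inv_subproof f)).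

Fact aut_mulA : associative aut_mul.
Proof. by move=> f g h; apply: val_inj. Qed.
Fact aut_mul1 : left_id aut_one aut_mul.
Proof. by move=> f; apply: val_inj. Qed.
Fact aut_mulr1 : right_id aut_one aut_mul.
Proof. by move=> f; apply: val_inj. Qed.
Fact aut_mulV : left_inverse aut_one aut_inv aut_mul.
Proof.
move=> f; apply: val_inj; apply/funext => x /=.
by case: (aut_inv_subproof f) => g _ [_ gK] /=; apply: gK.
Qed.
Fact aut_mulrV : right_inverse aut_one aut_inv aut_mul.
Proof.
move=> f; apply: val_inj; apply/funext => x /=.
by case: (aut_inv_subproof f) => g _ [fK _] /=; apply: fK.
Qed.

HB.instance Definition _ := isGroup.Build aut
  aut_mulA aut_mul1 aut_mulr1 aut_mulV aut_mulrV.

Lemma autM (f : aut) : {morph val f : x y / x * y}.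
Proof. by have /asboolP[] := valP f. Qed.

Lemma aut_invK (f : aut) : cancel (val f^-1) (val f).
Proof. by move=> x; rewrite -[RHS]/(val (1 : aut) x) -(mulVg f). Qed.

Lemma autK (f : aut) : cancel (val f) (val f^-1).
Proof. by move=> x; rewrite -[RHS]/(val (1 : aut) x) -(mulgV f). Qed.

End Automorphisms.

Definition F3 : groupType := freegroup 'I_3.

Definition conjugating : pred (aut F3) := fun phi =>
  `[< exists (p : {perm 'I_3}) (f : 'I_3 -> F3),
        forall i, val phi (fgen i) = (f i)^-1 * fgen (p i) * f i >].

Fact conjugating_group_closed : group_closed conjugating.
Proof.
split=> [|phi psi].
  apply/asboolP; exists 1%g, (fun=> 1) => i.
  by rewrite perm1 invg1 mul1g mulg1.
move=> /asboolP[p [f phiE]] /asboolP[s [g psiE]]; apply/asboolP.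
exists (p * s^-1)%g, (fun i => (val psi^-1 (g ((s^-1)%g (p i))))^-1
                               * val psi^-1 (f i)) => i.
rewrite -[LHS]/(val psi^-1 (val phi (fgen i))) phiE !autM !(gmorphV (@autM _ _)) permM.
set j := (s^-1)%g (p i).
have -> : fgen (p i) = g j * val psi (fgen j) * (g j)^-1.
  by rewrite psiE /j permKV !mulgA mulgV mul1g mulgK.
by rewrite !autM !(gmorphV (@autM _ _)) autK invgM invgK !mulgA.
Qed.

Definition C3 : Type := {phi : aut F3 | conjugating phi}.
Definition MkC3 (phi : aut F3) (phi_conj : conjugating phi) : C3 :=
  exist _ phi phi_conj.
HB.instance Definition _ := [isSub of C3 for @sval _ _].
HB.instance Definition _ := [Choice of C3 by <:].
HB.instance Definition _ :=
  SubChoice_isSubGroup.Build (aut F3) conjugating C3 conjugating_group_closed.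

Definition i1 : 'I_3 := @Ordinal 3 0 isT.
Definition i2 : 'I_3 := @Ordinal 3 1 isT.
Definition i3 : 'I_3 := @Ordinal 3 2 isT.
Definition x1 : F3 := fgen i1.
Definition x2 : F3 := fgen i2.
Definition x3 : F3 := fgen i3.

Lemma ord3P (P : 'I_3 -> Prop) : P i1 -> P i2 -> P i3 -> forall i, P i.
Proof.
move=> P1 P2 P3 [[|[|[|//]]] lt].
- by rewrite (_ : Ordinal lt = i1) //; apply: val_inj.
- by rewrite (_ : Ordinal lt = i2) //; apply: val_inj.
- by rewrite (_ : Ordinal lt = i3) //; apply: val_inj.
Qed.

Definition endo3 (a b c : F3) : F3 -> F3 :=
  fg_lift (fun i : 'I_3 => nth 1 [:: a; b; c] i).

Lemma endo3_is_aut (a b c a' b' c' : F3) :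
  (forall i, endo3 a' b' c' (endo3 a b c (fgen i)) == fgen i) ->
  (forall i, endo3 a b c (endo3 a' b' c' (fgen i)) == fgen i) ->
  is_aut (endo3 a b c).
Proof.
move=> h h'; apply/asboolP; split; first exact: fg_liftM.
exists (endo3 a' b' c').
  apply: fg_morph_ext => // [x y|i]; last exact/eqP.
  by rewrite /endo3 !fg_liftM.
apply: fg_morph_ext => // [x y|i]; last exact/eqP.
by rewrite /endo3 !fg_liftM.
Qed.

(* With the right action above, these are the standard generators for which the
   relations of C3_relations hold. *)
Definition sigma1_fun := endo3 (x1 * x2 * x1^-1) x1 x3.
Definition sigma2_fun := endo3 x1 (x2 * x3 * x2^-1) x2.
Definition alpha1_fun := endo3 x2 x1 x3.
Definition alpha2_fun := endo3 x1 x3 x2.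

Fact sigma1_aut : is_aut sigma1_fun.
Proof.
by apply: (@endo3_is_aut _ _ _ x2 (x2^-1 * x1 * x2) x3); apply: ord3P;
   vm_compute.
Qed.
Fact sigma2_aut : is_aut sigma2_fun.
Proof.
by apply: (@endo3_is_aut _ _ _ x1 x3 (x3^-1 * x2 * x3)); apply: ord3P;
   vm_compute.
Qed.
Fact alpha1_aut : is_aut alpha1_fun.
Proof. by apply: (@endo3_is_aut _ _ _ x2 x1 x3); apply: ord3P; vm_compute. Qed.
Fact alpha2_aut : is_aut alpha2_fun.
Proof. by apply: (@endo3_is_aut _ _ _ x1 x3 x2); apply: ord3P; vm_compute. Qed.

Fact sigma1_conj : conjugating (MkAut sigma1_aut).
Proof.
apply/asboolP; exists (tperm i1 i2), (fun i => if i == i1 then x1^-1 else 1).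
by apply: ord3P => /=; rewrite permE /=; apply/eqP; vm_compute.
Qed.
Fact sigma2_conj : conjugating (MkAut sigma2_aut).
Proof.
apply/asboolP; exists (tperm i2 i3), (fun i => if i == i2 then x2^-1 else 1).
by apply: ord3P => /=; rewrite permE /=; apply/eqP; vm_compute.
Qed.
Fact alpha1_conj : conjugating (MkAut alpha1_aut).
Proof.
apply/asboolP; exists (tperm i1 i2), (fun=> 1).
by apply: ord3P => /=; rewrite permE /=; apply/eqP; vm_compute.
Qed.
Fact alpha2_conj : conjugating (MkAut alpha2_aut).
Proof.
apply/asboolP; exists (tperm i2 i3), (fun=> 1).
by apply: ord3P => /=; rewrite permE /=; apply/eqP; vm_compute.
Qed.

Definition sigma1 : C3 := MkC3 sigma1_conj.
Definition sigma2 : C3 := MkC3 sigma2_conj.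
Definition alpha1 : C3 := MkC3 alpha1_conj.
Definition alpha2 : C3 := MkC3 alpha2_conj.

Lemma C3_eq (phi psi : C3) :
  (forall i, val (val phi) (fgen i) = val (val psi) (fgen i)) -> phi = psi.
Proof.
move=> h; do 2! apply: val_inj; apply/funext.
by apply: fg_morph_ext => //; apply: autM.
Qed.

Lemma C3_relations :
  [/\ sigma1 * sigma2 * sigma1 = sigma2 * sigma1 * sigma2,
      alpha1 * alpha1 = 1 /\ alpha2 * alpha2 = 1,
      alpha1 * alpha2 * alpha1 = alpha2 * alpha1 * alpha2,
      sigma1 * alpha2 * alpha1 = alpha2 * alpha1 * sigma2
    & sigma2 * sigma1 * alpha2 = alpha1 * sigma2 * sigma1].
Proof.
by do 2?split; apply: C3_eq; apply: ord3P; apply/eqP; vm_compute.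
Qed.

Definition T : C3 := sigma2 * alpha2 * alpha1.

Variant generator := Sigma1 | Sigma2 | Alpha1 | Alpha2.
HB.instance Definition _ := gen_eqMixin generator.

Definition gen_C3 (g : generator) : C3 :=
  match g with
  | Sigma1 => sigma1 | Sigma2 => sigma2 | Alpha1 => alpha1 | Alpha2 => alpha2
  end.

Definition expgz (G : groupType) (x : G) (n : int) : G :=
  match n with Posz m => x ^+ m | Negz m => x ^- m.+1 end.

(* The word g_1^(n_1) ... g_l^(n_l) is the list of the pairs (g_i, n_i). *)
Definition word : Type := seq (generator * int).

Definition word_length (w : word) : nat := \sum_(p <- w) `|p.2|%N.

Definition word_C3 (w : word) : C3 := \prod_(p <- w) expgz (gen_C3 p.1) p.2.

Definition alpha_words : seq word :=
  let a1 := (Alpha1, 1%R) in let a2 := (Alpha2, 1%R) in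
  [:: [:: a1]; [:: a2]; [:: a1; a2]; [:: a2; a1]; [:: a1; a2; a1]].

Definition alternating (A : nat -> word) (r : nat) : C3 :=
  (\prod_(1 <= i < r) (word_C3 (A i) * T)) * word_C3 (A r).

Local Open Scope ring_scope.

Section Units.
Variable R : unitRingType.

Definition units : Type := {x : R | x \is a GRing.unit}.
Definition MkUnit (x : R) (x_unit : x \is a GRing.unit) : units :=
  exist _ x x_unit.

HB.instance Definition _ := Choice.on units.

Definition units_one : units := MkUnit (unitr1 R).
Definition units_mul (x y : units) : units :=
  MkUnit (rpredM (valP x) (valP y)).
Definition units_inv (x : units) : units :=
  MkUnit (rpredVr (valP x)).

Fact units_mulA : associative units_mul.
Proof. by move=> x y z; apply: val_inj; apply: mulrA. Qed.
Fact units_mul1 : left_id units_one units_mul.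
Proof. by move=> x; apply: val_inj; apply: mul1r. Qed.
Fact units_mulr1 : right_id units_one units_mul.
Proof. by move=> x; apply: val_inj; apply: mulr1. Qed.
Fact units_mulV : left_inverse units_one units_inv units_mul.
Proof. by move=> x; apply: val_inj; apply: mulVr; apply: valP. Qed.
Fact units_mulrV : right_inverse units_one units_inv units_mul.
Proof. by move=> x; apply: val_inj; apply: mulrV; apply: valP. Qed.

HB.instance Definition _ := isGroup.Build units
  units_mulA units_mul1 units_mulr1 units_mulV units_mulrV.

End Units.

Notation GL3 C := (units 'M[C]_3).

Section Representation.
Variable C : fieldType.

Definition mx3 (rows : seq (seq C)) : 'M[C]_3 :=
  \matrix_(i < 3, j < 3) nth 0 (nth [::] rows i) j.

Definition is_rho (q : C) (rho : {multiplicative C3 -> GL3 C}) : Prop :=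
  [/\ val (rho sigma1) = mx3 [:: [:: q ^+ 2;        0;      0 ];
                                 [:: q * (q - 1);   1 - q;  q ];
                                 [:: 0;             1;      0 ]],
      val (rho sigma2) = mx3 [:: [:: 1 - q;  q;  q * (q - 1) ];
                                 [:: 1;      0;  0 ];
                                 [:: 0;      0;  q ^+ 2 ]],
      val (rho alpha1) = mx3 [:: [:: 1; 0; 0]; [:: 0; 0; 1]; [:: 0; 1; 0]]
    & val (rho alpha2) = mx3 [:: [:: 0; 1; 0]; [:: 1; 0; 0]; [:: 0; 0; 1]]].

(* Such a rho exists for every nonzero q (rho_exists): it is the symmetric
   square, in the basis (e_i - e_j)^2, of the reduced Burau representation
   extended to C_3 by Fox calculus. *)
Section Existence.
Variable q : C.
Hypothesis q0 : q != 0.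

Definition fox_cons (a : letter 'I_3) (d : 'rV[C]_3) : 'rV[C]_3 :=
  if a.2 then q^-1 *: (d - delta_mx 0 a.1) else delta_mx 0 a.1 + q *: d.
Definition fox_word (w : seq (letter 'I_3)) : 'rV[C]_3 := foldr fox_cons 0 w.
Definition deg_letter (a : letter 'I_3) : C := if a.2 then q^-1 else q.
Definition deg_word (w : seq (letter 'I_3)) : C := \prod_(a <- w) deg_letter a.
Definition fox (u : F3) : 'rV[C]_3 := fox_word (val u).
Definition deg (u : F3) : C := deg_word (val u).

Lemma fox_lcons a w : fox_word (lcons a w) = fox_cons a (fox_word w).
Proof.
case: w => //= b w; case: ifPn => // /eqP ->.
case: a => i [] /=; rewrite /fox_cons /=.
  by rewrite addrAC subrr add0r scalerA mulVf // scale1r.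
by rewrite scalerA mulfV // scale1r addrC subrK.
Qed.

Lemma deg_lcons a w : deg_word (lcons a w) = deg_letter a * deg_word w.
Proof.
case: w => [|b w] /=; rewrite /deg_word ?big_cons //; case: ifPn => // [/eqP ->|].
  rewrite mulrA; case: a => i [] /=; rewrite /deg_letter /=.
    by rewrite mulVf // mul1r.
  by rewrite mulfV // mul1r.
by rewrite !big_cons.
Qed.

Lemma deg_cons a w : deg_word (a :: w) = deg_letter a * deg_word w.
Proof. by rewrite /deg_word big_cons. Qed.

Lemma degM u v : deg (u * v)%g = deg u * deg v.
Proof.
rewrite /deg /=; case: u v => [u ru] [v rv] /=; elim: u {ru} => [|a u IHu] /=.
  by rewrite /deg_word big_nil mul1r.
by rewrite deg_lcons IHu deg_cons mulrA.
Qed.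

Lemma foxM u v : fox (u * v)%g = fox u + deg u *: fox v.
Proof.
rewrite /fox /deg /=; case: u v => [u ru] [v rv] /=.
elim: u {ru} => [|a u IHu] /=; first by rewrite /deg_word big_nil scale1r add0r.
rewrite fox_lcons IHu deg_cons /fox_cons /deg_letter.
case: a.2; rewrite !scalerDr !scalerA //; first by rewrite addrAC.
by rewrite addrA.
Qed.

Lemma deg1 : deg 1%g = 1. Proof. by rewrite /deg /deg_word big_nil. Qed.
Lemma fox1 : fox 1%g = 0. Proof. by []. Qed.
Lemma deg_unit u : deg u != 0.
Proof.
by apply/eqP => du; have := deg1; rewrite -(mulgV u) degM du mul0r => /esym/eqP;
   rewrite oner_eq0.
Qed.
Lemma degV u : deg (u^-1)%g = (deg u)^-1.
Proof.
by apply: (mulfI (deg_unit u)); rewrite -degM mulgV deg1 mulfV ?deg_unit.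
Qed.
Lemma foxV u : fox (u^-1)%g = - ((deg u)^-1 *: fox u).
Proof.
apply/eqP; rewrite -addr_eq0 -degV; apply/eqP.
by rewrite -foxM mulVg.
Qed.

Lemma deg_gen i : deg (fgen i) = q.
Proof. by rewrite /deg /deg_word big_seq1. Qed.
Lemma fox_gen i : fox (fgen i) = delta_mx 0 i.
Proof. by rewrite /fox /fox_word /= /fox_cons /= scaler0 addr0. Qed.

Definition ones : 'cV[C]_3 := const_mx 1.

Lemma delta_ones i : delta_mx 0 i *m ones = 1 :> 'M_1.
Proof.
apply/matrixP => a b; rewrite !ord1 mxE (bigD1 i) //= big1 => [|j ne].
  by rewrite !mxE !eqxx mulr1 addr0.
by rewrite !mxE (negbTE ne) andbF mul0r.
Qed.

Lemma fox_ones u : (q - 1) *: (fox u *m ones) = (deg u - 1)%:M.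
Proof.
elim/fg_ind: u => [|a u IHu].
  by rewrite fox1 mul0mx scaler0 deg1 subrr raddf0.
rewrite foxM mulmxDl scalerDr -scalemxAl scalerA mulrC -scalerA IHu degM.
rewrite /fg_letter; case: a.2; rewrite ?degV ?foxV ?deg_gen fox_gen.
  rewrite mulNmx -scalemxAl delta_ones -scaleNr scalerA -scalemx1 scalerA -scalerDl.
  by rewrite -scalemx1; congr (_ *: _); field.
rewrite delta_ones -scalemx1 scalerA -scalerDl -scalemx1.
by congr (_ *: _); ring.
Qed.

Definition burau (phi : C3) : 'M[C]_3 :=
  \matrix_i fox (val (val phi) (fgen i)).

Lemma deg_C3 (phi : C3) u : deg (val (val phi) u) = deg u.
Proof.
have phiM := autM (val phi).
have gen i : deg (val (val phi) (fgen i)) = q.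
  have /asboolP[p [f ->]] := valP phi.
  by rewrite !degM degV deg_gen mulrC mulrA mulfV ?deg_unit // mul1r.
elim/fg_ind: u => [|a u IHu]; first by rewrite (gmorph1 phiM).
rewrite phiM !degM IHu /fg_letter; case: a.2; last by rewrite gen deg_gen.
by rewrite (gmorphV phiM) !degV gen deg_gen.
Qed.

Lemma fox_C3 (phi : C3) u : fox (val (val phi) u) = fox u *m burau phi.
Proof.
have phiM := autM (val phi).
have gen i : fox (val (val phi) (fgen i)) = delta_mx 0 i *m burau phi.
  by rewrite -rowE rowK.
elim/fg_ind: u => [|a u IHu]; first by rewrite (gmorph1 phiM) fox1 mul0mx.
rewrite phiM !foxM IHu mulmxDl -scalemxAl deg_C3; congr (_ + _).
rewrite /fg_letter; case: a.2; last by rewrite gen fox_gen.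
by rewrite (gmorphV phiM) !foxV gen fox_gen deg_C3 mulNmx -scalemxAl.
Qed.

Lemma burauM phi psi : burau (phi * psi)%g = burau phi *m burau psi.
Proof. by apply/row_matrixP => i; rewrite row_mul !rowK -fox_C3. Qed.

Lemma burau1 : burau 1%g = 1%:M.
Proof. by apply/row_matrixP => i; rewrite rowK row1 -fox_gen. Qed.

Lemma burau_ones phi : burau phi *m ones = ones.
Proof.
apply/row_matrixP => i; rewrite row_mul rowK.
have /asboolP[p [f ->]] := valP phi.
rewrite !foxM !degM foxV degV deg_gen fox_gen !mulmxDl mulNmx -!scalemxAl.
rewrite delta_ones addrAC -scaleNr -scalerDl.
have -> : - (deg (f i))^-1 + (deg (f i))^-1 * q = (deg (f i))^-1 * (q - 1).
  by ring.
rewrite -scalerA fox_ones -scalerDr -scalemx1 -[X in _ *: (_ + X)]scale1r.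
rewrite -scalerDl subrK scalerA mulVf ?deg_unit // scale1r.
by apply/matrixP => a b; rewrite !ord1 !mxE.
Qed.

Definition sqr_row (u : 'I_3 -> C) : seq C :=
  [:: - (u i1 * u i2); - (u i1 * u i3); - (u i2 * u i3)].

Definition sym2 (M : 'M[C]_3) : 'M[C]_3 :=
  mx3 [:: sqr_row (fun j => M i1 j - M i2 j);
          sqr_row (fun j => M i1 j - M i3 j);
          sqr_row (fun j => M i2 j - M i3 j)].

Lemma sum3 (F : 'I_3 -> C) : \sum_i F i = F i1 + F i2 + F i3.
Proof.
rewrite !big_ord_recl big_ord0 addr0 addrA.
by congr (F _ + F _ + F _); apply: val_inj.
Qed.

Lemma sym2M (M N : 'M[C]_3) : M *m ones = ones ->
  sym2 (M *m N) = sym2 M *m sym2 N.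
Proof.
move=> M1.
have E i : M i i3 = 1 - M i i1 - M i i2.
  have /matrixP/(_ i 0) := M1; rewrite mxE sum3 !mxE !mulr1 => <-.
  by ring.
apply/matrixP; apply: ord3P; apply: ord3P; rewrite !mxE /= !mxE !sum3 !mxE /= !E;
  ring.
Qed.

Lemma sym2_1 : sym2 1%:M = 1%:M.
Proof.
by apply/matrixP; apply: ord3P; apply: ord3P; rewrite !mxE /= !mxE /=; ring.
Qed.

Definition sym2_burau (phi : C3) : 'M[C]_3 := sym2 (burau phi).

Lemma sym2_burauM phi psi :
  sym2_burau (phi * psi)%g = sym2_burau phi *m sym2_burau psi.
Proof. by rewrite /sym2_burau burauM sym2M // burau_ones. Qed.

Fact sym2_burau_unit phi : sym2_burau phi \is a GRing.unit.
Proof.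
apply/unitrP; exists (sym2_burau phi^-1%g).
by split; rewrite -[_ * _]sym2_burauM ?mulVg ?mulgV /sym2_burau burau1 sym2_1.
Qed.

Definition rho_fun (phi : C3) : GL3 C := MkUnit (sym2_burau_unit phi).

Fact rho_funM : {morph rho_fun : phi psi / (phi * psi)%g}.
Proof. by move=> phi psi; apply: val_inj; apply: sym2_burauM. Qed.

HB.instance Definition _ := isMultiplicative.Build C3 (GL3 C) rho_fun rho_funM.

Lemma burau_endo3 (phi : C3) a b c : val (val phi) = endo3 a b c ->
  [/\ burau phi i1 =1 fox a 0, burau phi i2 =1 fox b 0 & burau phi i3 =1 fox c 0].
Proof. by move=> E; split=> j; rewrite mxE E /endo3 fg_lift_gen. Qed.

Lemma rho_exists : exists rho : {multiplicative C3 -> GL3 C}, is_rho q rho.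
Proof.
exists rho_fun.
have [s11 s12 s13] := @burau_endo3 sigma1 _ _ _ erefl.
have [s21 s22 s23] := @burau_endo3 sigma2 _ _ _ erefl.
have [a11 a12 a13] := @burau_endo3 alpha1 _ _ _ erefl.
have [a21 a22 a23] := @burau_endo3 alpha2 _ _ _ erefl.
have E := (s11, s12, s13, s21, s22, s23, a11, a12, a13, a21, a22, a23).
split; rewrite /= /sym2_burau /sym2; apply/matrixP;
  apply: ord3P; apply: ord3P; rewrite !mxE /= !E /x1 /x2 /x3
    ?foxM ?foxV ?degM ?degV ?deg_gen ?fox_gen !mxE /=; field => //.
Qed.
End Existence.
End Representation.

Section ExceptionalSets.
Variable R : realType.
Local Notation C := R[i].

(* sqrtC picks one of the two square roots; since each condition is imposed for
   both signs, the sets do not depend on this choice. *)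
Definition Pset (k : int) : set C :=
  [set x | [/\ x != 0, x != 4,
     (2 * x) ^ (- (2 * k))
       * (x ^+ 2 - 2 * x - sqrtC ((x - 4) * x ^+ 3)) ^ (2 * k) = 1
   & (2 * x) ^ (- (2 * k))
       * (x ^+ 2 - 2 * x + sqrtC ((x - 4) * x ^+ 3)) ^ (2 * k) = 1]].

Definition Rset (k : int) : set C :=
  [set x | [/\ x != 0, x != 4^-1,
     (2 * x) ^ (- (2 * k)) * (1 - 2 * x - sqrtC (1 - 4 * x)) ^ (2 * k) = 1
   & (2 * x) ^ (- (2 * k)) * (1 - 2 * x + sqrtC (1 - 4 * x)) ^ (2 * k) = 1]].

(* The convention 0^-1 = 0 is harmless here: for k != 0 it leaves x = 1 outside
   the set. *)
Definition Sset (k : int) : set C :=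
  [set x | x != 0 /\ x ^ (- (2 * k)) * (1 - x) ^ (2 * k) = 1].

End ExceptionalSets.

(* Main.v *)
Require Import Defs.
From mathcomp Require Import all_boot all_order all_fingroup all_algebra.
From mathcomp Require Import complex boolp classical_sets reals.
From mathcomp Require Import ring.
Import GRing.Theory Num.Theory.
Local Open Scope ring_scope.

(* Put M = rho(A T), where A is the common value of the A_i. Both forms of x
   give M^r = rho(T)^r as soon as rho(x) = 1, and rho(T)^2 = q^2, whence
   M^(2r) = q^(2r). So every eigenvalue X of M satisfies X^(2r) = q^(2r), and M
   has no Jordan block of size 2 for a nonzero eigenvalue. For A = alpha1,
   alpha1 alpha2, alpha2 alpha1 the number 1 is an eigenvalue of M, hence
   q^(2r) = 1. For A = alpha2 the eigenvalues are q and the two roots of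
   X^2 - (q^2 - 2q) X + q^2, so q lies in P_r unless the roots coincide, i.e.
   q = 4, where M has a Jordan block. For A = alpha1 alpha2 alpha1 they are q
   and the roots of X^2 - (1 - 2q) X + q^2, which leads in the same way to R_r
   and q = 1/4. *)

(** * Powers of a matrix on eigenvectors and on Jordan chains of length two *)

Section MatrixPowers.
Set Implicit Arguments.
Unset Strict Implicit.
Variables (F : fieldType) (n : nat).
Implicit Types (M : 'M[F]_n.+1) (v w : 'cV[F]_n.+1).

Lemma exprmx_eigenvector M v a k :
  M *m v = a *: v -> M ^+ k *m v = a ^+ k *: v.
Proof.
move=> Mv; elim: k => [|k IHk]; first by rewrite !expr0 mul1mx scale1r.
by rewrite exprSr -mulmxA Mv -scalemxAr IHk scalerA exprS.
Qed.

Lemma exprmx_jordan M v w a k :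
  M *m v = a *: v -> M *m w = a *: w + v ->
  M ^+ k.+1 *m w = a ^+ k.+1 *: w + (a ^+ k *+ k.+1) *: v.
Proof.
move=> Mv Mw; elim: k => [|k IHk].
  by rewrite !expr1 expr0 Mw scale1r.
rewrite exprS -mulmxA IHk mulmxDr -!scalemxAr Mw Mv scalerDr !scalerA.
rewrite -!exprSr -addrA -scalerDl; congr (_ + _ *: _).
by rewrite mulrnAl -exprSr -mulrS.
Qed.

Lemma scalar_power_eigenvalue M v a b k :
  M ^+ k = b%:M -> M *m v = a *: v -> v != 0 -> a ^+ k = b.
Proof.
move=> Mk /(exprmx_eigenvector k); rewrite Mk mul_scalar_mx => /eqP.
rewrite -subr_eq0 -scalerBl scaler_eq0 subr_eq0 => /orP[/eqP->//|/eqP-> /eqP//].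
Qed.

(** On [w] the power acts as [a ^+ k.+1] plus the term [(k.+1) a^k v]. Since [b = a ^+ k.+1] by the
    eigenvector, this term vanishes, and in characteristic zero its coefficient does not. *)
Lemma scalar_power_no_jordan M v w a b k :
  [pchar F] =i pred0 -> M ^+ k.+1 = b%:M ->
  M *m v = a *: v -> M *m w = a *: w + v -> a != 0 -> v = 0.
Proof.
move=> F0 Mk Mv Mw a0; apply/eqP/negPn/negP => v0.
have ab := scalar_power_eigenvalue Mk Mv v0.
have := exprmx_jordan k Mv Mw.
rewrite Mk mul_scalar_mx -ab -[LHS]addr0 => /addrI/esym/eqP.
rewrite scaler_eq0 (negbTE v0) orbF -mulr_natr mulf_eq0 expf_eq0 (negbTE a0).
by rewrite andbF ((pcharf0P _).1 F0).
Qed.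

End MatrixPowers.

(** * Explicit arithmetic of 3 by 3 matrices and columns *)

Section ThreeByThree.
Variable F : fieldType.

Definition col3 (a b c : F) : 'cV[F]_3 := \col_i nth 0 [:: a; b; c] i.

Lemma mul_mx3_col3 (a b c d e f g h i x y z : F) :
  mx3 [:: [:: a; b; c]; [:: d; e; f]; [:: g; h; i]] *m col3 x y z
  = col3 (a * x + b * y + c * z) (d * x + e * y + f * z)
         (g * x + h * y + i * z).
Proof.
by apply/matrixP => j k; rewrite !mxE sum3 !mxE; move: j; apply: ord3P.
Qed.

Lemma mul_mx3 (a b c d e f g h i a' b' c' d' e' f' g' h' i' : F) :
  mx3 [:: [:: a; b; c]; [:: d; e; f]; [:: g; h; i]]
  *m mx3 [:: [:: a'; b'; c']; [:: d'; e'; f']; [:: g'; h'; i']]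
  = mx3 [:: [:: a * a' + b * d' + c * g'; a * b' + b * e' + c * h';
                a * c' + b * f' + c * i'];
            [:: d * a' + e * d' + f * g'; d * b' + e * e' + f * h';
                d * c' + e * f' + f * i'];
            [:: g * a' + h * d' + i * g'; g * b' + h * e' + i * h';
                g * c' + h * f' + i * i']].
Proof.
apply/matrixP => j k; rewrite !mxE sum3 !mxE.
by move: j k; apply: ord3P; apply: ord3P.
Qed.

Lemma scale_col3 (x a b c : F) : x *: col3 a b c = col3 (x * a) (x * b) (x * c).
Proof. by apply/matrixP => j k; rewrite !mxE; move: j; apply: ord3P. Qed.

Lemma add_col3 (a b c a' b' c' : F) :
  col3 a b c + col3 a' b' c' = col3 (a + a') (b + b') (c + c').
Proof. by apply/matrixP => j k; rewrite !mxE; move: j; apply: ord3P. Qed.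

Lemma col3_neq0 (a b c : F) : a != 0 -> col3 a b c != 0.
Proof. by apply: contraNneq => /matrixP/(_ i1 0); rewrite !mxE => /= ->. Qed.

Lemma scalar_mx3 (a : F) :
  a%:M = mx3 [:: [:: a; 0; 0]; [:: 0; a; 0]; [:: 0; 0; a]].
Proof. by apply/matrixP; apply: ord3P; apply: ord3P; rewrite !mxE. Qed.

End ThreeByThree.

Lemma val_units_exp (R : unitRingType) (u : units R) (n : nat) :
  val (u ^+ n)%g = val u ^+ n.
Proof. by elim: n => // n IHn; rewrite expgS exprS -IHn. Qed.

Lemma gmorphX (G H : groupType) (f : G -> H) (n : nat) :
  {morph f : x y / (x * y)%g} -> {morph f : x / (x ^+ n)%g}.
Proof.
move=> fM x; elim: n => [|n IHn]; first by rewrite !expg0 (gmorph1 fM).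
by rewrite !expgS fM IHn.
Qed.

Lemma val_multM (R : unitRingType) (G : groupType)
    (f : {multiplicative G -> units R}) (x y : G) :
  val (f (x * y)%g) = val (f x) * val (f y).
Proof. by rewrite gmulfM. Qed.

(** * The matrices of the products [A T] under [rho] *)

Section Rho.
Set Implicit Arguments.
Unset Strict Implicit.
Variables (F : fieldType) (q : F).
Variable (rho : {multiplicative C3 -> GL3 F}).
Hypothesis rhoE : is_rho q rho.

Lemma rho_T : val (rho T) =
  mx3 [:: [:: q; q * (q - 1); 1 - q]; [:: 0; 0; 1]; [:: 0; q ^+ 2; 0]].
Proof.
have [_ s2 a1 a2] := rhoE.
rewrite /T !val_multM s2 a1 a2 -!mulmxE !mul_mx3.
by rewrite !(mulr0, mulr1, addr0, add0r).
Qed.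

Lemma rho_T_sqr : val (rho T) ^+ 2 = (q ^+ 2)%:M.
Proof.
rewrite rho_T expr2 -mulmxE mul_mx3 scalar_mx3.
by congr (mx3 [:: [:: _; _; _]; [:: _; _; _]; [:: _; _; _]]); ring.
Qed.

(** The exponent is doubled because [rho T] is not scalar while its square is. *)
Lemma rho_alternating (a : C3) (r : nat) :
  rho ((a * T) ^+ r)%g = rho (T ^+ r)%g ->
  val (rho (a * T)%g) ^+ (2 * r) = (q ^+ (2 * r))%:M.
Proof.
move=> /(congr1 val); rewrite !(gmorphX _ (@gmulfM _ _ rho)) !val_units_exp => E.
rewrite mulnC exprM E -exprM mulnC exprM rho_T_sqr [q ^+ (2 * _)]exprM.
exact/esym/(rmorphXn (@scalar_mx F 3)).
Qed.

Lemma rho_alpha1_T : val (rho (alpha1 * T)%g) =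
  mx3 [:: [:: q; q * (q - 1); 1 - q]; [:: 0; q ^+ 2; 0]; [:: 0; 0; 1]].
Proof.
have [_ _ a1 _] := rhoE; rewrite val_multM a1 rho_T -mulmxE mul_mx3.
by rewrite !(mul0r, mul1r, addr0, add0r).
Qed.

Lemma rho_alpha2_T : val (rho (alpha2 * T)%g) =
  mx3 [:: [:: 0; 0; 1]; [:: q; q * (q - 1); 1 - q]; [:: 0; q ^+ 2; 0]].
Proof.
have [_ _ _ a2] := rhoE; rewrite val_multM a2 rho_T -mulmxE mul_mx3.
by rewrite !(mul0r, mul1r, addr0, add0r).
Qed.

Lemma rho_alpha12_T : val (rho (alpha1 * alpha2 * T)%g) =
  mx3 [:: [:: 0; 0; 1]; [:: 0; q ^+ 2; 0]; [:: q; q * (q - 1); 1 - q]].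
Proof.
have [_ _ a1 _] := rhoE.
rewrite -mulgA val_multM a1 rho_alpha2_T -mulmxE mul_mx3.
by rewrite !(mul0r, mul1r, addr0, add0r).
Qed.

Lemma rho_alpha21_T : val (rho (alpha2 * alpha1 * T)%g) =
  mx3 [:: [:: 0; q ^+ 2; 0]; [:: q; q * (q - 1); 1 - q]; [:: 0; 0; 1]].
Proof.
have [_ _ _ a2] := rhoE.
rewrite -mulgA val_multM a2 rho_alpha1_T -mulmxE mul_mx3.
by rewrite !(mul0r, mul1r, addr0, add0r).
Qed.

Lemma rho_alpha121_T : val (rho (alpha1 * (alpha2 * alpha1) * T)%g) =
  mx3 [:: [:: 0; q ^+ 2; 0]; [:: 0; 0; 1]; [:: q; q * (q - 1); 1 - q]].
Proof.
have [_ _ a1 _] := rhoE.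
rewrite -mulgA val_multM a1 rho_alpha21_T -mulmxE mul_mx3.
by rewrite !(mul0r, mul1r, addr0, add0r).
Qed.

(** * What a scalar power forces on [q], for each choice of [A] *)

Section ScalarPower.
Variable k : nat.
Hypothesis q0 : q != 0.

Lemma alpha1_scalar_power :
  val (rho (alpha1 * T)%g) ^+ k = (q ^+ k)%:M -> q ^+ k = 1.
Proof.
move=> /scalar_power_eigenvalue E; rewrite -(E (col3 1 0 1) 1) ?expr1n //.
  by rewrite rho_alpha1_T mul_mx3_col3 scale_col3; congr col3; ring.
exact/col3_neq0/oner_neq0.
Qed.

Lemma alpha12_scalar_power :
  val (rho (alpha1 * alpha2 * T)%g) ^+ k = (q ^+ k)%:M -> q ^+ k = 1.
Proof.
move=> /scalar_power_eigenvalue E; rewrite -(E (col3 1 0 1) 1) ?expr1n //.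
  by rewrite rho_alpha12_T mul_mx3_col3 scale_col3; congr col3; ring.
exact/col3_neq0/oner_neq0.
Qed.

Lemma alpha21_scalar_power :
  val (rho (alpha2 * alpha1 * T)%g) ^+ k = (q ^+ k)%:M -> q ^+ k = 1.
Proof.
move=> /scalar_power_eigenvalue E.
(* The first two entries come from the first row. The second row then gives
   [(1 - q) z = (1 - q) (q + 1)^2], so this [z] also works at [q = 1]. *)
rewrite -(E (col3 (q ^+ 2) 1 ((q + 1) ^+ 2)) 1) ?expr1n //.
  by rewrite rho_alpha21_T mul_mx3_col3 scale_col3; congr col3; ring.
by rewrite col3_neq0 // expf_neq0.
Qed.

(** The characteristic polynomial is [(X - q) (X^2 - (q^2 - 2q) X + q^2)]. Its first and third rows
    make [(q^2, X^2, X q^2)] the candidate eigenvector, and the second row is the cubic equation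
    itself. *)
Lemma alpha2_scalar_power (X : F) :
  X ^+ 2 = (q ^+ 2 - 2 * q) * X - q ^+ 2 ->
  val (rho (alpha2 * T)%g) ^+ k = (q ^+ k)%:M -> X ^+ k = q ^+ k.
Proof.
move=> X2 /scalar_power_eigenvalue; apply; last first.
  exact: (@col3_neq0 _ (q ^+ 2) (X ^+ 2) (X * q ^+ 2)) (expf_neq0 _ q0).
rewrite rho_alpha2_T mul_mx3_col3 scale_col3 X2; congr col3; first by ring.
  (* Expanding exposes [X ^+ 2] once more, so that the cubic reduces to degree one in [X]. *)
  have -> : X * ((q ^+ 2 - 2 * q) * X - q ^+ 2) =
            (q ^+ 2 - 2 * q) * X ^+ 2 - q ^+ 2 * X by ring.
  by rewrite X2; ring.
by rewrite -X2; ring.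
Qed.

(** The first two rows give the eigenvector [(q^2, X, X^2)], and the third is the characteristic
    equation [(X - q) (X^2 - (1 - 2q) X + q^2) = 0]. *)
Lemma alpha121_scalar_power (X : F) :
  X ^+ 2 = (1 - 2 * q) * X - q ^+ 2 ->
  val (rho (alpha1 * (alpha2 * alpha1) * T)%g) ^+ k = (q ^+ k)%:M ->
  X ^+ k = q ^+ k.
Proof.
move=> X2 /scalar_power_eigenvalue; apply; last first.
  exact: (@col3_neq0 _ (q ^+ 2) X (X ^+ 2)) (expf_neq0 _ q0).
rewrite rho_alpha121_T mul_mx3_col3 scale_col3 X2; congr col3; first by ring.
  by rewrite -X2; ring.
have -> : X * ((1 - 2 * q) * X - q ^+ 2) =
          (1 - 2 * q) * X ^+ 2 - q ^+ 2 * X by ring.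
by rewrite X2; ring.
Qed.

Lemma alpha2_no_scalar_power :
  [pchar F] =i pred0 -> q = 4 ->
  val (rho (alpha2 * T)%g) ^+ k.+1 != (q ^+ k.+1)%:M.
Proof.
move=> F0 q4; apply/eqP => /scalar_power_no_jordan.
(* The eigenvector [(q^2, X^2, X q^2)] and its derivative in [X], taken at [X = q = 4], form a
   Jordan chain: 4 is a multiple root of the characteristic polynomial. *)
move=> /(_ (col3 16 16 64) (col3 0 8 16) q F0) E.
suff /eqP : col3 16 16 64 = 0 :> 'cV[F]_3.
  apply/negP/col3_neq0.
  by rewrite ((pcharf0P _).1 F0).
apply: E => //; rewrite rho_alpha2_T mul_mx3_col3 scale_col3 ?add_col3 q4;
  congr col3; ring.
Qed.

Lemma alpha121_no_scalar_power :
  [pchar F] =i pred0 -> q = 4^-1 ->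
  val (rho (alpha1 * (alpha2 * alpha1) * T)%g) ^+ k.+1 != (q ^+ k.+1)%:M.
Proof.
move=> F0 q4; apply/eqP => /scalar_power_no_jordan.
have F4 : 4 != 0 :> F by rewrite ((pcharf0P _).1 F0).
(* Again the eigenvector [(q^2, X, X^2)] and its derivative in [X], at the multiple root [X = q]. *)
move=> /(_ (col3 (q ^+ 2) q (q ^+ 2)) (col3 0 1 (2 * q)) q F0) E.
suff /eqP : col3 (q ^+ 2) q (q ^+ 2) = 0.
  exact/negP/col3_neq0/expf_neq0.
apply: E => //; rewrite rho_alpha121_T mul_mx3_col3 scale_col3 ?add_col3 q4;
  congr col3; by [ring | field].
Qed.

End ScalarPower.

End Rho.

(** * From eigenvalues and words to the exceptional sets *)

Lemma exprz_quotient (F : fieldType) (q D : F) (r : nat) :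
  q != 0 -> 2 != 0 :> F -> (D / 2) ^+ (2 * r) = q ^+ (2 * r) ->
  (2 * q) ^ (- (2 * r%:Z)) * D ^ (2 * r%:Z) = 1.
Proof.
move=> q0 F2 E; rewrite -(PoszM 2 r) -invr_expz -!exprnP.
(* Writing [D] as [(D / 2) * 2] turns its power into that of [q * 2], which cancels the first
   factor. *)
rewrite -[D](divfK F2) [X in _ * X]exprMn E -exprMn (mulrC q) mulVf //.
by rewrite expf_neq0 // mulf_neq0.
Qed.

Lemma quadratic_root (F : fieldType) (b c s : F) :
  2 != 0 :> F -> s ^+ 2 = b ^+ 2 - 4 * c ->
  ((b + s) / 2) ^+ 2 = b * ((b + s) / 2) - c.
Proof.
move=> F2 s2; have F4 : 4 != 0 :> F by rewrite (natrM F 2 2) mulf_neq0.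
have -> : ((b + s) / 2) ^+ 2 = (b ^+ 2 + 2 * b * s + s ^+ 2) / 4.
  by field; rewrite F2 F4.
by rewrite s2; field; rewrite F2 F4.
Qed.

(** The factor [T] on the right completes the last block, since [alternating] ends in [A r]. *)
Lemma alternating_const (A : nat -> word) (w : word) (r : nat) :
  (1 <= r)%N -> (forall i, (1 <= i <= r)%N -> A i = w) ->
  (alternating A r * T = (word_C3 w * T) ^+ r)%g.
Proof.
case: r => // r _ Aw; rewrite /alternating Aw ?leqnn // -mulgA expgSr.
congr (_ * _)%g; rewrite big_add1 /=.
rewrite (eq_big_nat _ _ (F2 := fun=> (word_C3 w * T)%g)); last first.
  by move=> i ir; rewrite Aw //= ltnW.
elim: r {Aw} => [|r IHr]; first by rewrite big_nil.
by rewrite big_nat_recr //= IHr expgSr.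
Qed.

(** * Reduction to a scalar power and the five choices of [A] *)

Theorem theorem8 (R : realType) (q : R[i])
    (q_neq0 : q != 0)
    (q_root : forall k : int, k != 0 -> q ^ (6 * k) <> 1)
    (q_PR : forall m : int, m != 0 -> (2 %| m)%Z -> ~ (Pset m `|` Rset m)%classic q)
    (q_S : forall n : int, n != 0 -> ~ Sset n q)
    (rho : {multiplicative C3 -> GL3 R[i]}) (rhoE : is_rho q rho)
    (r : nat) (r_ge1 : (1 <= r)%N)
    (A : nat -> word)
    (A_alpha : forall i : nat, (1 <= i <= r)%N -> A i \in alpha_words)
    (A_even : ~~ odd (\sum_(1 <= i < r.+1) word_length (A i)))
    (x : C3)
    (xE : x = (alternating A r * expgz T (1 - r%:Z))%g \/
          x = (expgz T (1 - r%:Z) * alternating A r)%g) :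
  (forall i j : nat, (1 <= i <= r)%N -> (1 <= j <= r)%N -> A i = A j) ->
  rho x <> 1%g.
Proof.
move=> Aconst rhox.
have Aw i : (1 <= i <= r)%N -> A i = A 1%N by move=> ir; apply: Aconst.
have wA := A_alpha 1%N r_ge1.
have even_len : ~~ odd (r * word_length (A 1%N)).
  rewrite (_ : r * _ = \sum_(1 <= i < r.+1) word_length (A i))%N //.
  rewrite (eq_big_nat _ _ (F2 := fun=> word_length (A 1%N))).
    by rewrite sum_nat_const_nat subn1.
  by move=> i ir; rewrite Aw.
have expT : (expgz T (1 - r%:Z) = T ^- r.-1)%g.
  case: (r) r_ge1 => // [[_|n _]]; first by rewrite subrr /= expg0 invg1.
  by rewrite (_ : 1 - _ = Negz n) // NegzE -[in RHS]addn1 PoszD; ring.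
have rho_alt : rho (alternating A r) = rho (T ^+ r.-1)%g.
  move: rhox; case: xE => ->; rewrite expT gmulfM (gmorphV (@gmulfM _ _ rho)).
    by move=> /(canRL (mulgK _)); rewrite mul1g invgK.
  by move=> /(canRL (mulKg _)); rewrite mulg1 invgK.
have /(rho_alternating rhoE) : rho ((word_C3 (A 1%N) * T) ^+ r)%g = rho (T ^+ r)%g.
  rewrite -(alternating_const r_ge1 Aw) gmulfM rho_alt -gmulfM -expgSr.
  by rewrite prednK.
have C0 := Num.Theory.pchar_num R[i].
have C2 : 2 != 0 :> R[i] by rewrite ((pcharf0P _).1 C0).
have r2 : (2 * r = (2 * r).-1.+1)%N by rewrite prednK // muln_gt0.
(* Cubing [q^(2r) = 1] would give the excluded [q^(6r) = 1]. *)
have q_pow : q ^+ (2 * r) <> 1.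
  move=> q1; apply: (q_root r%:Z); first by rewrite -lt0n.
  by rewrite -(PoszM 6) -exprnP -(mulnA 3 2 r) mulnC exprM q1 expr1n.
have PR : ~~ odd r -> ~ (Pset r%:Z `|` Rset r%:Z)%classic q.
  by move=> r_even; apply: q_PR; rewrite -?lt0n // dvdzE /= dvdn2.
(* In the cases of odd length, 1 or 3, the parity condition becomes [r] even, as [PR] requires. *)
move: wA even_len; rewrite !inE => /or4P[|||/orP[]] /eqP->;
  rewrite /word_length /word_C3 !big_cons !big_nil /= ?expg1 ?mulg1 ?muln1 ?oddM
    ?andbT => r_even.
- by move=> /(alpha1_scalar_power rhoE).
- move=> Mr; case: (eqVneq q 4) => [q4|q_ne4].
    by move: Mr; rewrite r2; apply/eqP/alpha2_no_scalar_power.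
  have s2 := sqrtCK ((q - 4) * q ^+ 3); set s := sqrtC _ in s2.
  (* The discriminant is [(q^2 - 2q)^2 - 4 q^2 = (q - 4) q^3]. Taking [t] equal to [s] and to [- s]
     yields both conditions of [Pset]. *)
  have root t : t ^+ 2 = s ^+ 2 ->
      (2 * q) ^ (- (2 * r%:Z)) * (q ^+ 2 - 2 * q + t) ^ (2 * r%:Z) = 1.
    move=> t2; apply/exprz_quotient => //.
    apply: (alpha2_scalar_power rhoE) => //; apply: quadratic_root => //.
    by rewrite t2 s2; ring.
  apply: (PR r_even); left; split=> //; first exact/root/sqrrN.
  exact: root.
- by move=> /(alpha12_scalar_power rhoE).
- by move=> /(alpha21_scalar_power rhoE q_neq0).
- move=> Mr; case: (eqVneq q 4^-1) => [q4|q_ne4].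
    by move: Mr; rewrite r2; apply/eqP/alpha121_no_scalar_power.
  have s2 := sqrtCK (1 - 4 * q); set s := sqrtC _ in s2.
  (* Here the discriminant is [(1 - 2q)^2 - 4 q^2 = 1 - 4q]. *)
  have root t : t ^+ 2 = s ^+ 2 ->
      (2 * q) ^ (- (2 * r%:Z)) * (1 - 2 * q + t) ^ (2 * r%:Z) = 1.
    move=> t2; apply/exprz_quotient => //.
    apply: (alpha121_scalar_power rhoE) => //; apply: quadratic_root => //.
    by rewrite t2 s2; ring.
  apply: (PR r_even); right; split=> //; first exact/root/sqrrN.
  exact: root.
Qed.
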